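(* Let $q$ be a prime power, let $n\ge 3$ be an odd integer, and put $k=\mathbb{F}_{q^{2n}}$ and $m=(q^n+1)/(q+1)$. Let $c\in k^*$ with $c^{q^n}=-c$. The nonsingular projective curve $\mathcal{X}_{q,n}$ over $k$ with function field $k(u,z)$ given by $$z^{q^n+1}=c\,(u^q-u)\bigl(1+(u^q-u)^{q-1}\bigr)^{\frac{q^{n-1}-1}{q-1}}$$ is $\mathbb{F}_{q^{2n}}$-isomorphic to the Beelen--Montanucci curve, i.e. to the nonsingular projective curve over $k$ with function field $k(x,y,w)$ given by $$x^{q+1}-y^{q+1}=1,\qquad w^m=\frac{x^{q^2}-x}{y^q}.$$
   Context: An element $c\in k^*$ with $c^{q^n}=-c$ exists, and the $k$-isomorphism class of $\mathcal{X}_{q,n}$ does not depend on its choice. The Beelen--Montanucci curve is the geometrically irreducible nonsingular projective curve whose affine model is the displayed pair of equations in $x,y,w$. *)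

(* Defs.v *)
From HB Require Import structures.
From mathcomp Require Import all_boot all_order all_algebra.
From mathcomp Require Import mathcomp_extra boolp classical_sets functions.

Set Implicit Arguments.
Unset Strict Implicit.
Unset Printing Implicit Defensive.

Import GRing.Theory.
Local Open Scope ring_scope.
Local Open Scope classical_set_scope.

(* An integral projective scheme over k with function field K is represented  *)
(* by the set of its local rings, each regarded as a subring of K (Zariski's  *)
(* "models").  The scheme is separated, so a point is determined by its local *)
(* ring; the generic point is the local ring [setT], that is, K itself.       *)

Section Model.
Context {k K : fieldType} (iota : {rmorphism k -> K}).
Implicit Types (A P R : set K) (X U : set (set K)).

(* k[S] and k(S) inside K *)
Definition ring_adjoin (S : set K) : set K :=
  smallest [set A | subring_closed (mem A)] (range iota `|` S).

Definition field_adjoin (S : set K) : set K :=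
  smallest [set A | divring_closed (mem A)] (range iota `|` S).

Definition prime_ideal_of A P : Prop :=
  [/\ P `<=` A,
      P 0 /\ (forall a b, P a -> P b -> P (a + b)),
      forall a b, A a -> P b -> P (a * b),
      ~ P 1
    & forall a b, A a -> A b -> P (a * b) -> P a \/ P b].

Definition localization A P : set K := [set a / s | a in A & s in A `\` P].

(* The closed subscheme of P^N which is the closure of the K-point            *)
(* (f_0 : ... : f_N); its i-th affine chart is Spec k[f_0/f_i, ..., f_N/f_i]. *)
Definition projective_model (N : nat) (f : 'I_N.+1 -> K) : set (set K) :=
  [set R | exists i P,
     let A := ring_adjoin [set f j / f i | j in setT] in
     [/\ f i != 0, prime_ideal_of A P & R = localization A P]].

Definition projective_with_function_field X : Prop :=
  exists (N : nat) (f : 'I_N.+1 -> K),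
    [/\ exists i, f i != 0,
        field_adjoin [set f i / f j | i in setT & j in setT] = setT
      & X = projective_model f].

Definition nonunits R : set K :=
  [set a | R a /\ ~ (exists2 b, R b & a * b = 1)].

(* When K has transcendence degree 1 over k, the local rings other than K     *)
(* have Krull dimension 1, and such a ring is regular exactly when one        *)
(* element generates its maximal ideal.                                       *)
Definition nonsingular X : Prop :=
  forall R, X R -> R <> setT ->
    exists2 t, nonunits R t &
      forall a, nonunits R a -> exists2 b, R b & a = b * t.

(* Intended for K of transcendence degree 1 over k. *)
Definition nonsingular_projective_curve X : Prop :=
  projective_with_function_field X /\ nonsingular X.

(* The Zariski topology is generated by the domains of definition             *)
(* {R in X | a \in R} of the rational functions a in K.                       *)
Definition zariski_open X U : Prop :=
  U `<=` X /\
  forall R, U R -> exists s : seq K,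
    [set` s] `<=` R /\ (forall R', X R' -> [set` s] `<=` R' -> U R').

(* The structure sheaf.  Over U = set0 this is K instead of the zero ring,    *)
(* hence the restriction to nonempty opens in [curve_isomorphic].             *)
Definition sections U : set K := \bigcap_(R in U) R.

End Model.

Definition algebra_isomorphism (k E F : fieldType)
    (iE : {rmorphism k -> E}) (iF : {rmorphism k -> F})
    (A : set E) (B : set F) (h : E -> F) : Prop :=
  [/\ set_bij A B h,
      forall a, h (iE a) = iF a,
      forall a b, A a -> A b -> h (a + b) = h a + h b
    & forall a b, A a -> A b -> h (a * b) = h a * h b].

(* Isomorphism of k-ringed spaces: a homeomorphism phi together with an       *)
(* isomorphism O_Y -> phi_* O_X of sheaves of k-algebras.  All stalks are     *)
(* local rings, so such an isomorphism is local, i.e. one of k-schemes.       *)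
Definition curve_isomorphic (k K L : fieldType)
    (iK : {rmorphism k -> K}) (iL : {rmorphism k -> L})
    (X : set (set K)) (Y : set (set L)) : Prop :=
  exists (phi : set K -> set L) (theta : set (set L) -> L -> K),
    [/\ set_bij X Y phi,
        forall V, V `<=` Y ->
          (zariski_open Y V <-> zariski_open X (X `&` phi @^-1` V)),
        forall V, zariski_open Y V -> V !=set0 ->
          algebra_isomorphism iL iK
            (sections V) (sections (X `&` phi @^-1` V)) (theta V)
      & forall V W, zariski_open Y V -> zariski_open Y W ->
          W !=set0 -> W `<=` V ->
          forall a, sections V a -> theta W a = theta V a].

(* Main.v *)
(* Choose d in F_{q^2} outside F_q and put c' = d^q - d, so that c'^q = -c'.  *)
(* Since n is odd, c / c' lies in F_{q^n}, hence is a norm rho^(q^n + 1).     *)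
(* Putting s = c' / (x - y) and u = s y - d turns x^(q+1) - y^(q+1) = 1 into  *)
(* s^(q+1) = c' (u^q - u) and the second equation into                        *)
(* w^m = B s^(q - q^2) with B = 1 + (u^q - u)^(q-1).  Let                     *)
(* nu = (q^(n-1) - 1) / (q^2 - 1); since nu q (q - 1) = m - 1, the element    *)
(* z = rho s w^nu satisfies the equation of X_{q,n}, and w = B / (s w^nu)^r   *)
(* with r = q (q - 1), so u and z generate the function field.  The right     *)
(* hand side of the equation has a simple zero at u = 0, so the equation is   *)
(* irreducible by Eisenstein's criterion and the function fields are          *)
(* isomorphic over k.  Finally, the local rings of a nonsingular projective   *)
(* model of a function field of one variable are exactly the valuation rings  *)
(* of that field over k, so the field isomorphism carries one curve to the    *)
(* other.                                                                     *)

Require Import Defs.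
From HB Require Import structures.
From mathcomp Require Import all_boot all_order all_algebra.
From mathcomp Require Import mathcomp_extra boolp classical_sets functions.
From mathcomp Require Import cyclic.

Set Implicit Arguments.
Unset Strict Implicit.
Unset Printing Implicit Defensive.

Import GRing.Theory.
Local Open Scope ring_scope.
Local Open Scope classical_set_scope.

(** * Fraction fields and polynomial evaluation *)

(** The field k(x, y, w) has generators [u'], [z'] satisfying the equation of X_{q,n}: the plane
    curve x^(q+1) - y^(q+1) = 1 takes the form s^(q+1) = c' (u^q - u), and multiplying [s] by a
    power of [w] merges the two radicals into one of degree q^n + 1 ([BM_exponents], [BM_constants],
    [BM_radical_coordinates]). Both function fields are then the fraction field of one domain
    k[X][Y] / (Y^(q^n+1) - f(X)), because Eisenstein's criterion at the simple zero 0 of f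
    determines the kernel of evaluation ([eisenstein_radical], [eval_radical_eq0],
    [radical_extension_isom]).

    The passage from fields to curves rests on transcendence degree at most 1
    ([algebraically_dependent]). A local ring with principal maximal ideal is then a valuation ring,
    and every valuation ring over k has a centre on a projective model, whose local ring it must
    equal. Hence the points of each curve are all the valuation rings of its field
    ([nonsingular_projective_curve_valuations]), and a field isomorphism over k carries them over
    ([valuation_curves_isomorphic]). *)

Definition fraction_of (R : comNzRingType) (K : fieldType) (f : R -> K) :=
  forall x, exists a b, f b != 0 /\ x = f a / f b.

(** Equality of the kernels makes [g a / g b] depend only on [f a / f b]. The common kernel may be
    nonzero, so [R] can be a polynomial ring mapping onto a coordinate ring. *)
Lemma extend_to_fractions (R : comNzRingType) (K L : fieldType)
    (f : {rmorphism R -> K}) (g : {rmorphism R -> L}) :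
  fraction_of f -> (forall a, f a = 0 <-> g a = 0) ->
  exists h : {rmorphism K -> L}, forall a, h (f a) = g a.
Proof.
move=> fracf fg0.
have nz b : f b != 0 -> g b != 0.
  by apply: contra_neq => /fg0.
have [n_ /choice[d_ nd]] := choice fracf.
have d_nz x : f (d_ x) != 0 by case: (nd x).
have defx x : x * f (d_ x) = f (n_ x) by case: (nd x) => ? {1}->; rewrite divfK.
pose h x := g (n_ x) / g (d_ x).
have hE x a b : f b != 0 -> x * f b = f a -> h x = g a / g b.
  move=> b_nz xb; apply/eqP; rewrite eqr_div ?nz //.
  rewrite -subr_eq0 -!rmorphM -rmorphB; apply/eqP/fg0.
  by rewrite rmorphB !rmorphM /= -xb -defx mulrAC subrr.
have hB : zmod_morphism h.
  move=> x y; rewrite (hE _ (n_ x * d_ y - n_ y * d_ x) (d_ x * d_ y)).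
  - by rewrite rmorphB !rmorphM /= /h -[- (_ / _)]mulNr addf_div ?nz // mulNr.
  - by rewrite rmorphM mulf_neq0.
  - by rewrite rmorphB !rmorphM /= -!defx mulrBl !mulrA
      [y * _ * _]mulrAC.
have hM : monoid_morphism h.
  split=> [|x y].
    by rewrite (hE _ 1 1) ?rmorph1 ?divr1 ?oner_neq0 ?mulr1.
  rewrite (hE _ (n_ x * n_ y) (d_ x * d_ y)).
  - by rewrite !rmorphM /= /h mulf_div.
  - by rewrite rmorphM mulf_neq0.
  - by rewrite !rmorphM /= -!defx mulrACA.
pose H : {rmorphism K -> L} := HB.pack h
  (GRing.isZmodMorphism.Build K L h hB) (GRing.isMonoidMorphism.Build K L h hM).
exists H => a; rewrite /= (hE _ a 1) ?rmorph1 ?divr1 ?oner_neq0 //.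
by rewrite mulr1.
Qed.

Lemma fraction_field_fraction_of (R : idomainType) :
  fraction_of (@FracField.tofrac R).
Proof.
move=> x; exists \n_(repr x), \d_(repr x); split.
  by rewrite tofrac_eq0 denom_ratioP.
apply: (canRL (mulfK _)); first by rewrite tofrac_eq0 denom_ratioP.
rewrite -{1}[x]reprK; unlock FracField.tofrac.
rewrite -[LHS]FracField.pi_mul; apply/eqmodP => /=.
rewrite FracField.equivfE /FracField.mulf.
rewrite !numden_Ratio ?mulf_neq0 ?oner_neq0 ?denom_ratioP //.
by rewrite !mulr1 mulrC.
Qed.

Section PolynomialEvaluation.
Context {k K : fieldType} (iota : {rmorphism k -> K}).
Implicit Types (a b u v z : K) (S : set K).

Definition eval_poly u : {poly k} -> K := horner_eval u \o map_poly iota.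

HB.instance Definition _ u :=
  GRing.RMorphism.copy (eval_poly u) (horner_eval u \o map_poly iota).

Lemma eval_polyE u p : eval_poly u p = (map_poly iota p).[u].
Proof. by []. Qed.

Lemma eval_polyC u c : eval_poly u c%:P = iota c.
Proof. by rewrite eval_polyE map_polyC hornerC. Qed.

Lemma eval_polyX u : eval_poly u 'X = u.
Proof. by rewrite eval_polyE map_polyX hornerX. Qed.

Definition eval_polyXY u v : {poly {poly k}} -> K :=
  horner_eval v \o map_poly (eval_poly u).

HB.instance Definition _ u v :=
  GRing.RMorphism.copy (eval_polyXY u v)
    (horner_eval v \o map_poly (eval_poly u)).

Lemma eval_polyXYE u v p :
  eval_polyXY u v p = (map_poly (eval_poly u) p).[v].
Proof. by []. Qed.

Lemma eval_polyXYC u v p : eval_polyXY u v p%:P = eval_poly u p.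
Proof. by rewrite eval_polyXYE map_polyC hornerC. Qed.

Lemma eval_polyXYX u v : eval_polyXY u v 'X = v.
Proof. by rewrite eval_polyXYE map_polyX hornerX. Qed.

Lemma eval_swapXY u v p : eval_polyXY u v (swapXY p) = eval_polyXY v u p.
Proof.
have E x y r : eval_polyXY x y r = (map_poly (map_poly iota) r).[y%:P].[x].
  rewrite eval_polyXYE -(horner_evalE x) -[X in _ = _ X _]/(_ y%:P).
  rewrite -horner_map /= horner_evalE hornerC -map_poly_comp.
  by congr (horner _ _).
by rewrite !E -swapXY_map horner2_swapXY.
Qed.

Lemma eval_poly_eq0 u p :
  ~ algebraicOver iota u -> eval_poly u p = 0 -> p = 0.
Proof.
move=> tru pu0; apply/eqP/negP => /negP p_nz.
by apply: tru; exists p => //; apply/rootP.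
Qed.

Lemma field_adjoin_divring S : divring_closed (mem (field_adjoin iota S)).
Proof.
split=> [|x y|x y]; rewrite ?inE.
- by move=> A [[A1 _ _] _]; have := A1; rewrite inE.
- move=> xS yS A AS; have [[_ AB _] _] := AS; have := AB x y; rewrite !inE.
  by apply; [apply: xS | apply: yS].
- move=> xS yS A AS; have [[_ _ AM] _] := AS; have := AM x y; rewrite !inE.
  by apply; [apply: xS | apply: yS].
Qed.

Lemma field_adjoin_base S c : field_adjoin iota S (iota c).
Proof. by move=> A [_]; apply; left; exists c. Qed.

Lemma field_adjoin_gen S x : S x -> field_adjoin iota S x.
Proof. by move=> Sx A [_]; apply; right. Qed.

Lemma eval_polyXY_fraction u z :
  field_adjoin iota [set u; z] = setT -> fraction_of (eval_polyXY u z).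
Proof.
move=> uz_gen x.
pose A := [set x | exists a b : {poly {poly k}},
   eval_polyXY u z b != 0 /\ x = eval_polyXY u z a / eval_polyXY u z b].
have xK : field_adjoin iota [set u; z] x by rewrite uz_gen.
apply: (xK A); have e p : A (eval_polyXY u z p).
  by exists p, 1; rewrite rmorph1 oner_neq0 divr1.
split=> [|_ [[c _ <-]|[->|->]]]; last 3 first.
- by rewrite -(eval_polyC u) -(eval_polyXYC u z).
- by rewrite -{1}(eval_polyX u) -(eval_polyXYC u z).
- by rewrite -{1}(eval_polyXYX u z).
split=> [|y1 y2|y1 y2]; rewrite ?inE.
- by have := e 1; rewrite rmorph1.
- move=> [a [b [b0 ->]]] [a' [b' [b'0 ->]]].
  exists (a * b' - a' * b), (b * b'); rewrite rmorphB !rmorphM mulf_neq0 //=.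
  by rewrite -[- (_ / _)]mulNr addf_div // mulNr.
- move=> [a [b [b0 ->]]] [a' [b' [b'0 ->]]].
  have [a'0|a'0] := eqVneq (eval_polyXY u z a') 0.
    by rewrite a'0 mul0r invr0 mulr0; have := e 0; rewrite rmorph0.
  exists (a * b'), (b * a'); rewrite !rmorphM mulf_neq0 //=.
  by rewrite invf_div mulf_div.
Qed.

End PolynomialEvaluation.

(** * Transcendence degree at most one *)

Section AlgebraicDependence.
Context {k K : fieldType} (iota : {rmorphism k -> K}).
Implicit Types (a b u z : K).

Lemma algebraic_root_power (E : fieldType) (h : {rmorphism E -> K}) n z :
  (0 < n)%N -> algebraicOver h (z ^+ n) -> algebraicOver h z.
Proof.
move=> n_gt0 /integral_algebraic zn; apply/integral_algebraic.
apply: (@integral_root_monic _ _ _ _ ('X^n - (z ^+ n)%:P)).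
- exact: monicXnsubC.
- by rewrite rootE !hornerE subrr.
apply/integral_poly => i; rewrite coefB coefXn coefC.
apply: integral_sub; first exact: integral_nat.
by case: (i == 0)%N => //; apply: integral0.
Qed.

Lemma algebraic_eval_poly (E : fieldType) (h : {rmorphism E -> K}) u p :
    (forall c, algebraicOver h (iota c)) -> algebraicOver h u ->
  algebraicOver h (eval_poly iota u p).
Proof.
move=> algc /integral_algebraic intu; apply/integral_algebraic.
apply: integral_horner intu; apply/integral_poly => i.
by rewrite coef_map; apply/integral_algebraic/algc.
Qed.

Lemma algebraic_field_adjoin (E : fieldType) (h : {rmorphism E -> K}) S x :
    (forall c, algebraicOver h (iota c)) ->
    (forall s, S s -> algebraicOver h s) ->
  field_adjoin iota S x -> algebraicOver h x.
Proof.
move=> algc algS xS; apply: (xS [set y | algebraicOver h y]).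
split=> [|y [[c _ <-]|/algS//]]; last exact: algc.
split=> [|y1 y2|y1 y2]; rewrite ?inE.
- exact: algebraic1.
- exact: algebraic_sub.
- exact: algebraic_div.
Qed.

Lemma transcendental_fraction_morphism u : ~ algebraicOver iota u ->
  exists h : {rmorphism {fraction {poly k}} -> K},
    forall p, h (FracField.tofrac p) = eval_poly iota u p.
Proof.
move=> tru; apply: extend_to_fractions (@fraction_field_fraction_of _) _ => p.
split=> [/eqP|/(eval_poly_eq0 tru) ->]; last by rewrite rmorph0.
by rewrite tofrac_eq0 => /eqP ->; rewrite rmorph0.
Qed.

Lemma fraction_poly_clear_denominators (R : idomainType)
    (p : {poly {fraction R}}) :
  exists (d : R) (q : {poly R}),
    d != 0 /\ FracField.tofrac d *: p = map_poly (@FracField.tofrac R) q.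
Proof.
elim/poly_ind: p => [|p c [d [q [d0 dp]]]].
  by exists 1, 0; rewrite oner_neq0 scaler0 rmorph0.
have [n [e [e0 ->]]] := fraction_field_fraction_of c; rewrite tofrac_eq0 in e0.
exists (d * e), (e *: q * 'X + (d * n)%:P); split; first exact: mulf_neq0.
rewrite rmorphD (rmorphM (map_poly _)) /= map_polyX map_polyC map_polyZ.
rewrite -dp !rmorphM /=.
rewrite scalerDr scalerAl scalerA [_ * FracField.tofrac e]mulrC; congr (_ + _).
rewrite -mul_polyC -!polyCM tofracM; congr (_ %:P).
by rewrite [LHS]mulrC mulrA divfK ?tofrac_eq0 // mulrC.
Qed.

(** Clearing denominators turns an equation for [b] over k(a) into a polynomial relation between [a]
    and [b]; conversely, a nonzero relation stays nonzero over the fraction field. *)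
Lemma algebraic_over_fractionsP a b (h : {rmorphism {fraction {poly k}} -> K}) :
    (forall p, h (FracField.tofrac p) = eval_poly iota a p) ->
  algebraicOver h b <-> exists2 F, F != 0 & eval_polyXY iota a b F = 0.
Proof.
move=> hE; have mapE F : map_poly h (map_poly (@FracField.tofrac _) F)
    = map_poly (eval_poly iota a) F.
  by rewrite -map_poly_comp; apply: eq_map_poly => p; rewrite /= hE.
split=> [[p p0 /rootP pb0]|[F F0 Fb0]].
  have [d [q [d0 dp]]] := fraction_poly_clear_denominators p.
  exists q; last by rewrite eval_polyXYE -mapE -dp map_polyZ hornerZ pb0 mulr0.
  apply: contraNneq p0 => q0; move: dp; rewrite q0 rmorph0 => /eqP.
  by rewrite scaler_eq0 tofrac_eq0 (negPf d0).
exists (map_poly (@FracField.tofrac _) F); last by apply/rootP; rewrite mapE.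
by rewrite map_poly_eq0_id0 // tofrac_eq0 lead_coef_eq0.
Qed.

(** An exchange argument: everything is algebraic over k(u). For [a] transcendental, swapping the
    variables in a relation between [u] and [a] shows that [u], hence the whole field, is algebraic
    over k(a). *)
Lemma algebraically_dependent u z n f :
    field_adjoin iota [set u; z] = setT -> (0 < n)%N ->
    z ^+ n = eval_poly iota u f ->
  forall a b, exists2 F, F != 0 & eval_polyXY iota a b F = 0.
Proof.
move=> uz_gen n_gt0 zn a b.
have algK (E : fieldType) (h : {rmorphism E -> K}) x :
    (forall c, algebraicOver h (iota c)) -> algebraicOver h u ->
    algebraicOver h x.
  move=> algc algu; have: field_adjoin iota [set u; z] x by rewrite uz_gen.
  apply: algebraic_field_adjoin => // _ [->//|->].
  apply: (algebraic_root_power n_gt0); rewrite zn.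
  exact: algebraic_eval_poly.
have algc v (h : {rmorphism {fraction {poly k}} -> K}) c :
    (forall p, h (FracField.tofrac p) = eval_poly iota v p) ->
    algebraicOver h (iota c).
  by move=> hE; rewrite -(eval_polyC iota v) -hE; apply: algebraic_id.
have [[p p0 /rootP pa]|tra] := pselect (algebraicOver iota a).
  by exists p%:P; rewrite ?polyC_eq0 // eval_polyXYC.
have tru : ~ algebraicOver iota u.
  by move=> algu; apply: tra; apply: algK algu => c; apply: algebraic_id.
have [ha haE] := transcendental_fraction_morphism tra.
have [hu huE] := transcendental_fraction_morphism tru.
apply/(algebraic_over_fractionsP _ haE); apply: (algK _ _ _ _) => [c|].
  exact: algc haE.
apply/(algebraic_over_fractionsP _ haE).
have algu : algebraicOver hu u.
  rewrite -[X in algebraicOver _ X](eval_polyX iota) -huE.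
  exact: algebraic_id.
have : algebraicOver hu a by apply: algK algu => c; apply: algc huE.
move=> /(algebraic_over_fractionsP _ huE)[F F0 Fa].
by exists (swapXY F); rewrite ?swapXY_eq0 // eval_swapXY.
Qed.

End AlgebraicDependence.

(** * Radical extensions *)

Section RadicalExtension.
Context {k : fieldType} (f : {poly k}) (n : nat).
Hypotheses (f_root0 : root f 0) (f_simple0 : ~~ root f^`() 0).
Hypothesis (n_gt0 : (0 < n)%N).

(** Reduction of the coefficients modulo the prime ['X] of k['X]. *)
Local Notation at0 := (map_poly (horner_eval (0 : k))).

Lemma at0_eq0_factor (p : {poly {poly k}}) :
  at0 p = 0 -> exists p', p = 'X%:P * p'.
Proof.
move=> p0; exists (map_poly (fun a : {poly k} => a %/ 'X) p).
apply/polyP => i; rewrite coefCM coef_map_id0 ?div0p // mulrC divpK //.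
rewrite -['X]subr0 -polyC0 dvdp_XsubCl; apply/rootP.
by move/polyP/(_ i): p0; rewrite coef_map coef0.
Qed.

(* Eisenstein's criterion at the prime 'X of k['X]; the factor [a] makes it a *)
(* statement over k('X).                                                      *)
Lemma eisenstein_radical (a : {poly k}) (g h : {poly {poly k}}) :
  a != 0 -> a%:P * ('X^n - f%:P) = g * h -> (size h <= 1)%N \/ (n < size h)%N.
Proof.
have [m] := ubnP (size a); elim: m a g h => // m IHm a g h le_am a0 agh.
have at0gh : a.[0] *: 'X^n = at0 g * at0 h.
  rewrite -rmorphM -agh rmorphM rmorphB /= map_polyXn !map_polyC /=.
  rewrite !horner_evalE.
  by rewrite (rootP f_root0) subr0 mul_polyC.
(* If ['X] divides [a], the reduction of [g * h] is 0, so ['X] divides [g] or [h] and can be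
   cancelled, lowering the degree of [a]. *)
have [ar|ar] := boolP (root a 0).
  have [a' aE] : exists a', a = 'X * a'.
    exists (a %/ 'X); rewrite mulrC divpK // -['X]subr0 -polyC0 dvdp_XsubCl //.
  have X0 : 'X%:P != 0 :> {poly {poly k}} by rewrite polyC_eq0 polyX_eq0.
  have a'0 : a' != 0 by apply: contraNneq a0 => a'0; rewrite aE a'0 mulr0.
  have le_a' : (size a' < m)%N.
    by rewrite -ltnS; move: le_am; rewrite aE mulrC size_mulX.
  move/eqP: at0gh; rewrite (rootP ar) scale0r eq_sym mulf_eq0 => /orP[] /eqP.
    case/at0_eq0_factor => g' gE; apply: (IHm a' g') => //.
    by apply: (mulfI X0); rewrite mulrA -polyCM -aE agh gE mulrA.
  case/at0_eq0_factor => h' hE.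
  suff <- : size h' = size h.
    apply: (IHm a' g) => //; apply: (mulfI X0).
    by rewrite mulrA -polyCM -aE agh hE mulrCA.
  by rewrite hE mul_polyC size_scale ?polyX_eq0.
have [le_h|lt_h] := leqP (size h) 1; first by left.
have [//|le_hn] := ltnP n (size h); first by right.
exfalso.
have sz : size (a%:P * ('X^n - f%:P)) = n.+1.
  by rewrite mul_polyC size_scale // size_XnsubC.
have gh0 : g * h != 0 by rewrite -agh -size_poly_eq0 sz.
have [g0 h0] : g != 0 /\ h != 0.
  by move: gh0; rewrite mulf_eq0 negb_or => /andP[].
have sgh : (size g + size h = n.+2)%N.
  have := size_mul g0 h0; rewrite -agh sz => ->.
  by rewrite prednK // addn_gt0 size_poly_gt0 g0.
have sz0 : (size (at0 g) + size (at0 h) = n.+2)%N.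
  have /eqP : size (a.[0] *: 'X^n) = n.+1 by rewrite size_scale // size_polyXn.
  have at0_neq0 : at0 g * at0 h != 0.
    by rewrite -at0gh scaler_eq0 negb_or ar -size_poly_eq0 size_polyXn.
  move: (at0_neq0); rewrite mulf_eq0 negb_or => /andP[g'0 h'0].
  rewrite at0gh size_mul // => /eqP <-.
  by rewrite prednK // addn_gt0 size_poly_gt0 g'0.
(* Reduction cannot raise a degree, and the sums of the sizes agree, so neither factor loses its
   leading term. *)
have sg : size (at0 g) = size g.
  have le_sz (r : {poly {poly k}}) : (size (at0 r) <= size r)%N.
    exact: size_poly.
  apply/eqP; rewrite eqn_leq le_sz /= -(leq_add2r (size h)) sgh -sz0.
  by rewrite leq_add2l le_sz.
have sh : size (at0 h) = size h.
  by apply/eqP; rewrite -(eqn_add2l (size g)) -{1}sg sz0 sgh.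
(* If [s] did not vanish at 0, it would be coprime to ['X^n], which would then divide the cofactor
   [r], whose degree is below [n]. *)
have root0 (r s : {poly k}) : (1 < size s)%N -> (size r + size s = n.+2)%N ->
    r * s = a.[0] *: 'X^n -> root s 0.
  move=> s1 srs rs; apply/negPn/negP => s0.
  have cop : coprimep 'X^n s.
    by rewrite coprimep_expl // -['X]subr0 -polyC0 coprimep_sym coprimep_XsubC.
  have Xn_r : 'X^n %| r by rewrite -(Gauss_dvdpl r cop) rs dvdpZr.
  have r0 : r != 0.
    apply: contraNneq ar => r0; move/eqP: rs.
    by rewrite r0 mul0r eq_sym scaler_eq0 -size_poly_eq0 size_polyXn orbF.
  have := dvdp_leq r0 Xn_r; rewrite size_polyXn => lt_r.
  by have := leq_add lt_r s1; rewrite srs addn2 ltnn.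
have hr : root (at0 h) 0.
  by apply: (root0 (at0 g)); rewrite ?sh ?sg -?at0gh.
have gr : root (at0 g) 0.
  apply: (root0 (at0 h)); rewrite ?sh ?sg // 1?addnC // 1?mulrC -?at0gh //.
  rewrite ltnNge; apply/negP => g1.
  by have := leq_add g1 le_hn; rewrite sgh add1n ltnn.
have c0 (r : {poly {poly k}}) : root (at0 r) 0 -> exists r', r`_0 = 'X * r'.
  move=> /rootP; rewrite horner_coef0 coef_map /= horner_evalE => /eqP r0.
  exists (r`_0 %/ 'X); rewrite mulrC divpK // -['X]subr0 -polyC0 dvdp_XsubCl //.
have [[g' gE] [h' hE]] := (c0 _ gr, c0 _ hr).
(* Both constant terms are divisible by ['X], so [a * f] has a double zero at 0, although [a] is
   nonzero there and the zero of [f] is simple. *)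
have : a * f = 'X * ('X * - (g' * h')).
  have /polyP/(_ 0%N) := agh; rewrite coefCM coefB coefXn coefC eqxx coef0M.
  rewrite gE hE eq_sym; case: n n_gt0 => //= _ _.
  rewrite sub0r mulrN => /(congr1 -%R).
  by rewrite opprK => ->; rewrite !mulrN mulrACA -mulrA.
move/(congr1 (fun p => p^`().[0])); rewrite /= !derivM !derivX !hornerE.
rewrite (rootP f_root0) mulr0 add0r => /eqP.
by rewrite mulf_eq0 -!rootE (negPf ar) (negPf f_simple0).
Qed.

(** A nonzero [p] of degree below [n] killed by evaluation leaves a smaller killed remainder
    [N %% p], which is 0 by induction. So [p] divides [N] up to a factor in k[X]; Eisenstein makes
    [p] constant in the outer variable, against the transcendence of [u]. *)
Lemma eval_radical_eq0 (K : fieldType) (iota : {rmorphism k -> K}) u z p :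
    ~ algebraicOver iota u -> z ^+ n = eval_poly iota u f ->
  eval_polyXY iota u z p = 0 <-> p %% ('X^n - f%:P) = 0.
Proof.
move=> tru zn; set N := 'X^n - f%:P.
have monN : N \is monic by exact: monicXnsubC.
have evN : eval_polyXY iota u z N = 0.
  rewrite /N eval_polyXYE rmorphB /= map_polyXn map_polyC !hornerE.
  by rewrite zn subrr.
have evmod : eval_polyXY iota u z p = eval_polyXY iota u z (p %% N).
  rewrite {1}(Pdiv.IdomainMonic.divp_eq monN p) rmorphD rmorphM /=.
  by rewrite evN mulr0 add0r.
rewrite evmod; split=> [|->]; last exact: rmorph0.
have : (size (p %% N)%R <= n)%N.
  have sN : size N = n.+1 by exact: size_XnsubC.
  by rewrite -ltnS -sN ltn_modp monic_neq0.
move: (p %% N) => {evmod}p; have [m] := ubnP (size p).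
elim: m p => // m IHm p; rewrite ltnS => le_pm le_pn evp.
apply/eqP/negPn/negP => p0.
have lt_mod : (size (N %% p)%R < size p)%N by rewrite ltn_modp.
(* This is pseudo-division: [N] gets multiplied by a power of [lead_coef p], which becomes the
   factor [a] of [eisenstein_radical]. *)
have divN := Pdiv.Idomain.divp_eq N p.
have Np : N %% p = 0.
  apply: IHm; first exact: leq_trans lt_mod le_pm.
    exact: ltnW (leq_trans lt_mod le_pn).
  move/(congr1 (eval_polyXY iota u z)): divN.
  by rewrite -mul_polyC rmorphD !rmorphM /= evN evp !mulr0 add0r.
have lc0 : lead_coef p ^+ scalp N p != 0 by rewrite expf_neq0 // lead_coef_eq0.
move: divN; rewrite Np addr0 -mul_polyC => /(eisenstein_radical lc0)[].
  move/size1_polyC => pE; move: evp p0; rewrite pE eval_polyXYC.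
  by move/(eval_poly_eq0 tru) ->; rewrite eqxx.
by rewrite ltnNge le_pn.
Qed.

Lemma radical_extension_isom (K L : fieldType)
    (iK : {rmorphism k -> K}) (iL : {rmorphism k -> L}) u z u' z' :
    ~ algebraicOver iK u -> z ^+ n = eval_poly iK u f ->
    field_adjoin iK [set u; z] = setT ->
    ~ algebraicOver iL u' -> z' ^+ n = eval_poly iL u' f ->
    field_adjoin iL [set u'; z'] = setT ->
  exists (h : {rmorphism L -> K}) (g : {rmorphism K -> L}),
    [/\ cancel h g, cancel g h & forall a, h (iL a) = iK a].
Proof.
move=> tru zn genK tru' zn' genL.
pose e' : {rmorphism {poly {poly k}} -> L} := eval_polyXY iL u' z'.
pose e : {rmorphism {poly {poly k}} -> K} := eval_polyXY iK u z.
have ee' p : e p = 0 <-> e' p = 0.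
  apply: iff_trans (eval_radical_eq0 p tru zn) _.
  exact: iff_sym (eval_radical_eq0 p tru' zn').
have fracK := eval_polyXY_fraction genK.
have fracL := eval_polyXY_fraction genL.
have [g gE] := @extend_to_fractions _ _ _ e e' fracK ee'.
have [h hE] := @extend_to_fractions _ _ _ e' e fracL (fun p => iff_sym (ee' p)).
exists h, g; split=> [x|x|a].
- by have [a [b [_ ->]]] := fracL x; rewrite !fmorph_div /= !hE !gE.
- by have [a [b [_ ->]]] := fracK x; rewrite !fmorph_div /= !gE !hE.
rewrite -(eval_polyC iL u') -(eval_polyXYC iL u' z') -[LHS]/(h (e' _)) hE.
by rewrite [e _]eval_polyXYC eval_polyC.
Qed.

End RadicalExtension.

(** * Valuation rings and nonsingular models *)

Section ValuationRings.
Context {k K : fieldType} (iota : {rmorphism k -> K}).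
Implicit Types (A P R V S : set K) (X : set (set K)).

Lemma subring_closedP A : subring_closed (mem A) <->
  [/\ A 1, forall a b, A a -> A b -> A (a - b)
         & forall a b, A a -> A b -> A (a * b)].
Proof.
split=> [[A1 AB AM]|[A1 AB AM]].
  split=> [|a b Aa Ab|a b Aa Ab].
  - by move: A1; rewrite inE.
  - by have := AB a b; rewrite !inE; apply.
  - by have := AM a b; rewrite !inE; apply.
split=> [|a b|a b]; rewrite !inE //; [exact: AB | exact: AM].
Qed.

Section Subring.
Context A (subA : subring_closed (mem A)).

Lemma subring1 : A 1.
Proof. by have [] := (subring_closedP A).1 subA. Qed.

Lemma subringB a b : A a -> A b -> A (a - b).
Proof. by have [_ + _] := (subring_closedP A).1 subA; apply. Qed.

Lemma subringM a b : A a -> A b -> A (a * b).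
Proof. by have [_ _] := (subring_closedP A).1 subA; apply. Qed.

Lemma subring0 : A 0.
Proof. by rewrite -(subrr 1); apply: subringB subring1 subring1. Qed.

Lemma subringN a : A a -> A (- a).
Proof. by rewrite -sub0r; apply: subringB subring0. Qed.

Lemma subringD a b : A a -> A b -> A (a + b).
Proof. by move=> Aa Ab; rewrite -[b]opprK; apply/subringB/subringN. Qed.

Lemma subringX a n : A a -> A (a ^+ n).
Proof.
move=> Aa; elim: n => [|n An]; first exact: subring1.
by rewrite exprS; apply: subringM.
Qed.

Lemma subring_eval_poly a p :
  range iota `<=` A -> A a -> A (eval_poly iota a p).
Proof.
move=> iotaA Aa; elim/poly_ind: p => [|p c Ap].
  by rewrite rmorph0; apply: subring0.
rewrite rmorphD rmorphM /= eval_polyX eval_polyC.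
by apply: subringD; [exact: subringM | apply: iotaA; exists c].
Qed.

End Subring.

Lemma ring_adjoin_subring S : subring_closed (mem (ring_adjoin iota S)).
Proof.
apply/subring_closedP; split=> [|a b aS bS|a b aS bS] A [subA AS].
- exact: subring1.
- by apply: subringB => //; [apply: aS | apply: bS].
- by apply: subringM => //; [apply: aS | apply: bS].
Qed.

Lemma ring_adjoin_base S : range iota `<=` ring_adjoin iota S.
Proof. by move=> c cS A [_ AS]; apply: AS; left. Qed.

Lemma ring_adjoin_gen S : S `<=` ring_adjoin iota S.
Proof. by move=> s Ss A [_ AS]; apply: AS; right. Qed.

Lemma ring_adjoin_min S A :
  subring_closed (mem A) -> range iota `<=` A -> S `<=` A ->
  ring_adjoin iota S `<=` A.
Proof. by move=> subA iotaA SA a; apply; split=> // x [/iotaA|/SA]. Qed.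

(** The whole field qualifies, as the trivial valuation; it is the generic point. *)
Definition valuation_ring V : Prop :=
  [/\ subring_closed (mem V), range iota `<=` V & forall a, V a \/ V a^-1].

Section ValuationRing.
Context V (valV : valuation_ring V).

Let subV : subring_closed (mem V). Proof. by have [] := valV. Qed.

(** This ideal is the centre of [V] on the chart [A], formed by the nonunits of [V]. Zero is listed
    apart because [0^-1 = 0] lies in [V]. *)
Lemma valuation_ring_prime A : subring_closed (mem A) -> A `<=` V ->
  prime_ideal_of A [set a | A a /\ (a = 0 \/ ~ V a^-1)].
Proof.
move=> subA AV; have [_ _ val] := valV.
have nonunitM a b : A a -> b = 0 \/ ~ V b^-1 -> a * b = 0 \/ ~ V (a * b)^-1.
  move=> Aa [->|nVb]; first by rewrite mulr0; left.
  have [->|a0] := eqVneq a 0; first by rewrite mul0r; left.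
  right=> Vab; apply: nVb.
  have -> : b^-1 = a * (a * b)^-1 by rewrite invfM mulVKf.
  by apply: (subringM subV) => //; apply: AV.
split=> [a []//|||[_ [/eqP|]]|a b Aa Ab [_ ab]].
- split=> [|a b [Aa a0] [Ab b0]]; first by split; [exact: subring0 | left].
  split; first exact: subringD.
  have [->|a_nz] := eqVneq a 0; first by rewrite add0r.
  have [->|b_nz] := eqVneq b 0; first by rewrite addr0.
  have [->|ab_nz] := eqVneq (a + b) 0; [by left | right => Vab].
  case: (val (a / b)) => [Vq|]; last rewrite invf_div => Vq.
    case: b0 => [/eqP|]; [by rewrite (negPf b_nz) | apply].
    have -> : b^-1 = (a / b + 1) * (a + b)^-1.
      by rewrite -[X in _ + X](divff b_nz) -mulrDl mulrAC divff ?mul1r.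
    apply: (subringM subV) => //; apply: (subringD subV) => //.
    exact: subring1.
  case: a0 => [/eqP|]; [by rewrite (negPf a_nz) | apply].
  have -> : a^-1 = (1 + b / a) * (a + b)^-1.
    by rewrite -[X in X + _](divff a_nz) -mulrDl mulrAC divff ?mul1r.
  apply: (subringM subV) => //; apply: (subringD subV) => //.
  exact: subring1.
- by move=> a b Aa [Ab b0]; split; [exact: subringM | exact: nonunitM].
- by rewrite oner_eq0.
- by rewrite invr1; apply; apply: subring1.
- have [->|a0] := eqVneq a 0; first by left; split; [exact: subring0 | left].
  have [->|b0] := eqVneq b 0; first by right; split; [exact: subring0 | left].
  have [Va|nVa] := pselect (V a^-1); last by left; split=> //; right.
  have [Vb|nVb] := pselect (V b^-1); last by right; split=> //; right.
  case: ab => [/eqP|]; first by rewrite mulf_eq0 (negPf a0) (negPf b0).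
  by case; rewrite invfM; apply: subringM.
Qed.

(** The index [i] is that of a coordinate of least valuation. It selects the affine chart on which
    [V] has a centre, as in the valuative criterion of properness. *)
Lemma valuation_ring_dominant (I : eqType) (f : I -> K) (s : seq I) :
    (exists2 i, i \in s & f i != 0) ->
  exists2 i, f i != 0 & forall j, j \in s -> V (f j / f i).
Proof.
have [_ _ val] := valV; have [V0 V1] := (subring0 subV, subring1 subV).
elim: s => [[i]//|j s IHs [i]].
have [s0|s_nz] := pselect (exists2 i, i \in s & f i != 0) => i_js fi.
  have [i0 fi0 Vi0] := IHs s0.
  have [Vj|Vj] := val (f j / f i0).
    by exists i0 => // l; rewrite inE => /predU1P[->|/Vi0].
  have [fj0|fj_nz] := eqVneq (f j) 0.
    by exists i0 => // l; rewrite inE => /predU1P[->|/Vi0//]; rewrite fj0 mul0r.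
  exists j => // l; rewrite inE => /predU1P[->|/Vi0 Vl]; first by rewrite divff.
  have -> : f l / f j = f l / f i0 * (f j / f i0)^-1.
    by rewrite invf_div mulrA divfK.
  exact: subringM.
move: i_js; rewrite inE => /predU1P[ij|ins]; last by case: s_nz; exists i.
exists i => // l; rewrite inE ij => /predU1P[->|lns].
  by rewrite -ij divff.
have [->|fl] := eqVneq (f l) 0; first by rewrite mul0r.
by case: s_nz; exists l.
Qed.

End ValuationRing.

Section Localization.
Context A P (subA : subring_closed (mem A)) (primeP : prime_ideal_of A P).

Lemma localizationP a :
  localization A P a <-> exists b s, [/\ A b, A s, ~ P s & a = b / s].
Proof.
split=> [[b Ab [s [As Ps] <-]]|[b [s [Ab As Ps ->]]]]; first by exists b, s.
by exists b => //; exists s.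
Qed.

Lemma prime_ideal_neq0 s : ~ P s -> s != 0.
Proof. by have [_ [P0 _] _ _ _] := primeP; apply: contra_notN => /eqP ->. Qed.

Lemma localization_base : A `<=` localization A P.
Proof.
have [_ _ _ P1 _] := primeP.
move=> a Aa; apply/localizationP; exists a, 1; rewrite divr1.
by split=> //; apply: subring1.
Qed.

Lemma localization_subring : subring_closed (mem (localization A P)).
Proof.
have [_ _ _ _ primP] := primeP.
have nPM s t : A s -> A t -> ~ P s -> ~ P t -> ~ P (s * t).
  by move=> As At nPs nPt /(primP _ _ As At)[].
apply/subring_closedP; split=> [|x y|x y].
- by apply: localization_base; apply: subring1.
- move=> /localizationP[a [s [Aa As Ps ->]]].
  move=> /localizationP[b [t [Ab At Pt ->]]]; apply/localizationP.
  exists (a * t - b * s), (s * t); split; last first.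
  + by rewrite -[- (_ / _)]mulNr addf_div ?prime_ideal_neq0 // mulNr.
  + exact: nPM.
  + exact: subringM.
  + by apply: subringB => //; apply: subringM.
- move=> /localizationP[a [s [Aa As Ps ->]]].
  move=> /localizationP[b [t [Ab At Pt ->]]]; apply/localizationP.
  exists (a * b), (s * t); split; last by rewrite mulf_div.
  + exact: subringM.
  + exact: subringM.
  + exact: nPM.
Qed.

End Localization.

End ValuationRings.

Section ValuationModel.
Context {k K : fieldType} (iota : {rmorphism k -> K}).
Hypothesis dependent : forall a b,
  exists2 F, F != 0 & eval_polyXY iota a b F = 0.
Implicit Types (A P R V S : set K) (X : set (set K)).

(* No Noetherian hypothesis is needed for Krull's intersection theorem: if a  *)
(* lies in every t^n R, then reducing an algebraic relation between a and t   *)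
(* to its lowest-order term puts a power of t in a R.                         *)
Lemma principal_nonunits_valuation_ring R t :
    subring_closed (mem R) -> range iota `<=` R ->
    (forall x, exists a b, [/\ R a, R b, b != 0 & x = a / b]) ->
    nonunits R t -> (forall a, nonunits R a -> exists2 b, R b & a = b * t) ->
  valuation_ring iota R.
Proof.
move=> subR iotaR fracR [Rt ntR] genR; split=> // x.
have Riota c : R (iota c) by apply: iotaR; exists c.
have unitP a : R a -> ~ nonunits R a -> R a^-1.
  move=> Ra /not_andP[]// /contrapT[b Rb ab].
  have a0 : a != 0.
    by apply: contra_eq_neq ab => ->; rewrite mul0r eq_sym oner_neq0.
  by have -> : a^-1 = b by apply: (mulfI a0); rewrite ab mulfV.
(* If [t = 0], every nonzero element of [R] is a unit, so [R] is all of [K]. *)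
have [t0|t_nz] := eqVneq t 0.
  left; have [a [b [Ra Rb b_nz ->]]] := fracR x.
  apply: subringM => //; apply: unitP => // /genR[c _].
  by rewrite t0 mulr0 => /eqP; rewrite (negPf b_nz).
have lowest G : G != 0 -> exists n c s,
    [/\ c != 0, R s & eval_poly iota t G = t ^+ n * (iota c + s * t)].
  elim/poly_ind: G => [/eqP//|G c IH Gc].
  rewrite rmorphD rmorphM /= eval_polyX eval_polyC.
  have [c0|c_nz] := eqVneq c 0.
    have [|n [d [s [d0 Rs ->]]]] := IH.
      by apply: contraNneq Gc => ->; rewrite mul0r add0r c0.
    by exists n.+1, d, s; split=> //; rewrite c0 rmorph0 addr0 exprSr mulrAC.
  exists 0%N, c, (eval_poly iota t G); split=> //.
    exact: subring_eval_poly.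
  by rewrite expr0 mul1r addrC.
(* Dividing the relation by the largest possible power of [a] leaves a nonzero constant term G(t),
   which is a multiple of [a] in [R]. *)
have lowest2 a F : R a -> a != 0 -> F != 0 -> eval_polyXY iota t a F = 0 ->
    exists G s, [/\ G != 0, R s & eval_poly iota t G = s * a].
  move=> Ra a0; have RF H : R (eval_polyXY iota t a H).
    elim/poly_ind: H => [|H c RH]; first by rewrite rmorph0; apply: subring0.
    rewrite rmorphD rmorphM /= eval_polyXYX eval_polyXYC.
    by apply: subringD; [| apply: subringM | apply: subring_eval_poly].
  elim/poly_ind: F => [/eqP//|F c IH Fc].
  rewrite rmorphD rmorphM /= eval_polyXYX eval_polyXYC.
  have [c0|c_nz] := eqVneq c 0.
    rewrite c0 rmorph0 addr0 => /eqP; rewrite mulf_eq0 (negPf a0) orbF => /eqP.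
    by apply: IH; apply: contraNneq Fc => ->; rewrite mul0r add0r c0.
  move=> /eqP; rewrite addrC addr_eq0 -mulNr => /eqP cE.
  by exists c, (- eval_polyXY iota t a F); split=> //; apply: subringN.
have factor a : R a -> a != 0 ->
    exists n v, [/\ R v, R v^-1, v != 0 & a = t ^+ n * v].
  move=> Ra a0; apply: contrapT => nfactor.
  have divt n : exists2 b, R b & a = t ^+ n * b.
    elim: n => [|n [b Rb aE]]; first by exists a; rewrite ?expr0 ?mul1r.
    have [nRb|nRb] := pselect (nonunits R b).
      have [b' Rb' bE] := genR b nRb.
      by exists b' => //; rewrite aE bE exprSr -mulrA [t * _]mulrC.
    case: nfactor; exists n, b; split=> //; first exact: unitP.
    by apply: contraNneq a0 => b0; rewrite aE b0 mulr0.
  have [F F0 Fta] := dependent t a.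
  have [G [s [G0 Rs Gt]]] := lowest2 a F Ra a0 F0 Fta.
  have [n [c [s' [c0 Rs' Gt']]]] := lowest G G0.
  have [b Rb aE] := divt n.+1.
  have tn0 : t ^+ n != 0 by rewrite expf_neq0.
  (* The two expressions for G(t) put the nonzero constant [iota c] into the ideal of [t], so [t]
     would be a unit. *)
  have : iota c + s' * t = (s * b) * t.
    apply: (mulfI tn0); rewrite -Gt' Gt aE exprSr.
    by rewrite -!mulrA mulrCA [t * b]mulrC.
  move/(canRL (addrK _)); rewrite -mulrBl => cE.
  apply: ntR; exists ((s * b - s') * (iota c)^-1).
    apply: subringM => //; last by rewrite -fmorphV.
    by apply: subringB => //; apply: subringM.
  by rewrite mulrA [t * _]mulrC -cE divff ?fmorph_eq0.
have [a [b [Ra Rb b0 ->]]] := fracR x.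
have [->|a0] := eqVneq a 0; first by left; rewrite mul0r; apply: subring0.
have [n [v [Rv Rv' v0 ->]]] := factor a Ra a0.
have [m [w [Rw Rw' w0 ->]]] := factor b Rb b0.
have Rquot i j y z : (j <= i)%N -> R y -> R z^-1 ->
    R ((t ^+ i * y) / (t ^+ j * z)).
  move=> le_ji Ry Rz; rewrite -(subnK le_ji) exprD invfM.
  have -> : t ^+ (i - j) * t ^+ j * y * ((t ^+ j)^-1 / z)
          = t ^+ (i - j) * (y / z).
    rewrite mulrACA mulfK ?expf_neq0 //.
  by apply: subringM => //; [apply: subringX | apply: subringM].
have [le_mn|/ltnW le_nm] := leqP m n; first by left; apply: Rquot.
by right; rewrite invf_div; apply: Rquot.
Qed.

Lemma projective_chart_fractions (N : nat) (f : 'I_N.+1 -> K) i :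
    f i != 0 ->
    field_adjoin iota [set f i / f j | i in setT & j in setT] = setT ->
  let A := ring_adjoin iota [set f j / f i | j in setT] in
  forall x, exists a b, [/\ A a, A b, b != 0 & x = a / b].
Proof.
move=> fi0 gen A x.
have subA : subring_closed (mem A) by exact: ring_adjoin_subring.
have xK : field_adjoin iota [set f i / f j | i in setT & j in setT] x.
  by rewrite gen.
apply: (xK [set x | exists a b, [/\ A a, A b, b != 0 & x = a / b]]).
have Af j : A (f j / f i) by apply: ring_adjoin_gen; exists j.
have Ac c : A (iota c) by apply: ring_adjoin_base; exists c.
clearbody A; split=> [|y [[c _ <-]|[j _ [l _ <-]]]].
- split=> [|y1 y2|y1 y2]; rewrite ?inE.
  + by exists 1, 1; rewrite divr1 oner_neq0; split=> //; apply: subring1.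
  + move=> [a [b [Aa Ab b0 ->]]] [a' [b' [Aa' Ab' b'0 ->]]].
    exists (a * b' - a' * b), (b * b'); split; last first.
    * by rewrite -[- (_ / _)]mulNr addf_div // mulNr.
    * by rewrite mulf_neq0.
    * exact: subringM.
    * by apply: subringB => //; apply: subringM.
  + move=> [a [b [Aa Ab b0 ->]]] [a' [b' [Aa' Ab' b'0 ->]]].
    have [->|a'0] := eqVneq a' 0.
      exists 0, 1; rewrite mul0r invr0 mulr0 mul0r oner_neq0.
      by split=> //; [apply: subring0 | apply: subring1].
    exists (a * b'), (b * a'); rewrite invf_div mulf_div mulf_neq0 //.
    by split=> //; apply: subringM.
- exists (iota c), 1; rewrite divr1 oner_neq0; split=> //.
  exact: subring1.
- have [->|fl] := eqVneq (f l) 0.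
    exists 0, 1; rewrite invr0 mulr0 mul0r oner_neq0.
    by split=> //; [apply: subring0 | apply: subring1].
  exists (f j / f i), (f l / f i); split=> //.
    by rewrite mulf_neq0 ?invr_neq0.
  by rewrite invf_div mulrA divfK.
Qed.

(** Valuation rings are maximal for domination. If [x] lies in [V] and x^-1 = b / s lies in [R],
    then [b] is a unit of [V], hence outside the centre [P], and x = s / b lies in [R]. *)
Lemma valuation_ring_maximal R V (P A : set K) :
    subring_closed (mem A) -> prime_ideal_of A P -> R = localization A P ->
    valuation_ring iota R -> valuation_ring iota V -> A `<=` V ->
    P = [set a | A a /\ (a = 0 \/ ~ V a^-1)] ->
  R = V.
Proof.
move=> subA primeP RE [subR _ valR] [subV _ _] AV PE.
apply/seteqP; split=> x.
  rewrite RE => /localizationP[a [s [Aa As Ps ->]]].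
  apply: subringM => //; first exact: AV.
  by move: Ps; rewrite PE => /not_andP[//|/not_orP[_ /contrapT]].
move=> Vx; have [//|] := valR x.
rewrite {1}RE => /localizationP[b [s [Ab As Ps xE]]].
have [->|x0] := eqVneq x 0; first exact: subring0.
have b0 : b != 0.
  by apply: contra_eq_neq xE => ->; rewrite mul0r invr_neq0.
have s0 := prime_ideal_neq0 primeP Ps.
have xE' : x = s / b by rewrite -[x]invrK xE invf_div.
rewrite RE; apply/localizationP; exists s, b; split=> //.
rewrite PE => -[_ [/eqP|]]; first by rewrite (negPf b0).
apply; have -> : b^-1 = x * s^-1 by rewrite xE' mulrAC divff ?mul1r.
apply: subringM => //.
by move: Ps; rewrite PE => /not_andP[//|/not_orP[_ /contrapT]].
Qed.

(** Regularity makes every local ring a valuation ring. Conversely, a valuation ring dominates the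
    local ring of its centre, and domination between valuation rings is equality. *)
Lemma nonsingular_projective_curve_valuations X :
  nonsingular_projective_curve iota X -> X = [set V | valuation_ring iota V].
Proof.
case=> [[N [f [[i0 fi0] gen XE]]] nsX].
pose A i := ring_adjoin iota [set f j / f i | j in setT].
have subA i : subring_closed (mem (A i)) by exact: ring_adjoin_subring.
have valX R : X R -> valuation_ring iota R.
  move=> XR; have [->|Rproper] := pselect (R = setT).
    by split=> [|//|a]; [apply/subring_closedP | left].
  have [t Rt genR] := nsX R XR Rproper.
  move: XR; rewrite XE => -[i [P [fi primeP RE]]].
  have subR : subring_closed (mem R).
    by rewrite RE; apply: (localization_subring (subA i) primeP).
  have AR : A i `<=` R.
    by rewrite RE; apply: (localization_base (subA i) primeP).
  apply: (principal_nonunits_valuation_ring (t := t)) => //.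
    by move=> c cE; apply: AR; apply: ring_adjoin_base.
  move=> x; have [a [b [Aa Ab b0 xE]]] := projective_chart_fractions fi gen x.
  by exists a, b; split=> //; apply: AR.
apply/seteqP; split=> [V|V valV]; first exact: valX.
have [|i fi Vi] := @valuation_ring_dominant _ _ _ V valV _ f (enum 'I_N.+1).
  by exists i0; rewrite ?mem_enum.
have [subV iotaV _] := valV.
have AV : A i `<=` V.
  apply: ring_adjoin_min => // _ [j _ <-]; apply: Vi.
  by rewrite mem_enum.
have primeP := valuation_ring_prime valV (subA i) AV.
set P := [set a | _] in primeP.
have XR : X (localization (A i) P) by rewrite XE; exists i, P.
rewrite -(valuation_ring_maximal (subA i) primeP erefl _ valV AV erefl) //.
exact: valX.
Qed.

End ValuationModel.

(** * Transport of valuation rings along a field isomorphism *)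

Lemma preimage_valuation_ring (k K L : fieldType) (iK : {rmorphism k -> K})
    (iL : {rmorphism k -> L}) (h : {rmorphism L -> K}) (V : set K) :
  (forall a, h (iL a) = iK a) -> valuation_ring iK V ->
  valuation_ring iL (h @^-1` V).
Proof.
move=> hi [/subring_closedP[V1 VB VM] iV val]; split=> [|_ [a _ <-]|a] /=.
- apply/subring_closedP; split=> [|a b|a b] /=;
    rewrite ?rmorph1 ?rmorphB ?rmorphM //.
  + exact: VB.
  + exact: VM.
- by rewrite hi; apply: iV; exists a.
- by rewrite fmorphV; apply: val.
Qed.

(** Points are pulled back along [h], and every sheaf map is [h] itself. Basic open sets correspond
    by applying [h] or [g] to the finite list of functions that defines them. *)
Lemma valuation_curves_isomorphic (k K L : fieldType) (iK : {rmorphism k -> K})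
    (iL : {rmorphism k -> L}) (h : {rmorphism L -> K})
    (g : {rmorphism K -> L}) :
    cancel h g -> cancel g h -> (forall a, h (iL a) = iK a) ->
  curve_isomorphic iK iL
    [set V | valuation_ring iK V] [set V | valuation_ring iL V].
Proof.
move=> hK gK hi; set X := [set V | _]; set Y := [set V | valuation_ring iL V].
have gi a : g (iK a) = iL a by rewrite -hi hK.
have phiX R : X R -> Y (h @^-1` R) by exact: preimage_valuation_ring.
have psiY S : Y S -> X (g @^-1` S) by exact: preimage_valuation_ring.
have psiK (R : set K) : g @^-1` (h @^-1` R) = R.
  by apply/seteqP; split=> x /=; rewrite gK.
have phiK (S : set L) : h @^-1` (g @^-1` S) = S.
  by apply/seteqP; split=> x /=; rewrite hK.
exists (fun R => h @^-1` R), (fun _ => h); split.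
- split=> [R /phiX //|R R' _ _ RR'|S /psiY XS].
    by rewrite -(psiK R) RR' psiK.
  by exists (g @^-1` S).
- move=> V VY; split=> -[_ openV].
    split=> [R [] //|R [XR VR]].
    have [s [sR sV]] := openV _ VR; exists (map h s); split=> [|R' XR' sR'].
      by move=> _ /= /mapP[y ys ->]; apply: sR.
    split=> //; apply: sV; first exact: phiX.
    by move=> y /= ys; apply: sR'; apply: map_f.
  split=> // S VS; have [|s [sR sV]] := openV (g @^-1` S).
    by split; [exact/psiY/VY | rewrite /= phiK].
  exists (map g s); split=> [_ /= /mapP[y ys ->]|S' YS' sS']; first exact: sR.
  rewrite -(phiK S'); apply: (sV _ _ _).2; first exact: psiY.
  by move=> y /= ys; apply: sS'; apply: map_f.
- move=> V [VY _] _; split=> [|//|a b _ _|a b _ _];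
    rewrite ?rmorphD ?rmorphM //.
  split=> [a Va R [XR VR]|a b _ _ /(can_inj hK)//|b Ub]; first exact: Va VR.
  exists (g b) => // S VS; apply: (Ub (g @^-1` S)).
  by split; [exact/psiY/VY | rewrite /= phiK].
- by [].
Qed.

(** * The change of coordinates *)

(** As [n - 1] is even, q^2 - 1 divides q^(n-1) - 1, with quotient [nu]; the identities follow from
    q^(n-1) = nu (q^2 - 1) + 1. *)
Lemma BM_exponents q n : (1 < q)%N -> odd n ->
  exists nu, [/\ ((q ^ (n - 1) - 1) %/ (q - 1) = nu * (q + 1))%N,
                 ((q ^ n + 1) %/ (q + 1) = nu * (q * (q - 1)) + 1)%N
               & (q ^ n + 1 = (nu * (q * (q - 1)) + 1) * (q + 1))%N].
Proof.
move=> q_gt1 odd_n; have q_gt0 := ltnW q_gt1.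
have nE : (n = n./2 * 2 + 1)%N.
  by rewrite -{1}(odd_double_half n) odd_n addnC muln2.
have q2 : (q ^ 2 - 1 = (q - 1) * (q + 1))%N by rewrite -[1%N](exp1n 2) subn_sqr.
have /dvdnP[nu nuE] : (q ^ 2 - 1 %| q ^ (n - 1) - 1)%N.
  rewrite nE addnK mulnC expnM !subn1; exact: dvdn_pred_predX.
have qnE : (q ^ n = q * (nu * (q ^ 2 - 1) + 1))%N.
  rewrite -nuE subnK ?expn_gt0 ?q_gt0 // -expnS subn1 prednK //.
  by case: (n) odd_n.
have qnE1 : (q ^ n + 1 = (nu * (q * (q - 1)) + 1) * (q + 1))%N.
  rewrite qnE q2 mulnDr muln1 mulnDl mul1n -addnA; congr (_ + _)%N.
  by rewrite !mulnA [(q * nu)%N]mulnC.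
exists nu; split=> //.
  by rewrite nuE q2 [((q - 1) * _)%N]mulnC mulnA mulnK // subn_gt0.
by rewrite qnE1 mulnK // addn1.
Qed.

(** * Finite fields and the constants of the coordinate change *)

Lemma finField_expf_card (F : finFieldType) (x : F) :
  x != 0 -> x ^+ #|F|.-1 = 1.
Proof.
move=> x0; have P0 : \prod_(y : F | y != 0) y != 0 by apply/prodf_neq0.
apply: (mulIf P0); rewrite mul1r [RHS](reindex_inj (mulfI x0)) /=.
rewrite [RHS](eq_bigl (fun y => y != 0)) => [|y]; last first.
  by rewrite mulf_eq0 negb_or x0.
rewrite big_split prodr_const /=; congr (x ^+ _ * _).
by rewrite -(cardC1 (0 : F)); apply: eq_card.
Qed.

Lemma finField_pchar (F : finFieldType) p m :
  prime p -> #|F| = (p ^ m)%N -> p \in [pchar F].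
Proof.
move=> p_pr card_F; rewrite inE p_pr /=.
have : #|F|%:R = 0 :> F.
  have : \sum_(y : F) y = \sum_(y : F) (y + 1).
    exact: (reindex_inj (addIr 1)).
  by rewrite big_split /= sumr_const -[LHS]addr0 => /addrI.
by rewrite card_F natrX => /eqP; rewrite expf_eq0 => /andP[].
Qed.

Lemma finField_primitive_root (F : finFieldType) :
  exists g : F, (#|F|.-1).-primitive_root g.
Proof.
have card_gt1 := card_finNzRing_gt1 F.
have /hasP[g _ gprim] : has (#|F|.-1).-primitive_root (enum (predC1 (0 : F))).
  apply: has_prim_root; rewrite ?enum_uniq //.
  - by rewrite -subn1 subn_gt0.
  - apply/allP => x; rewrite mem_enum inE unity_rootE => x0.
    by rewrite finField_expf_card.
  - by rewrite -cardE cardC1.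
by exists g.
Qed.

(** Both [c] and d^q - d are negated by the q^n-power map, so their quotient lies in F_{q^n}, and
    the norm x^(q^n+1) from k^* onto the units of that field is surjective. *)
Lemma BM_constants (k : finFieldType) q n c :
    (1 < q)%N -> [pchar k].-nat q -> odd n -> #|k| = (q ^ (2 * n))%N ->
    c != 0 -> c ^+ (q ^ n) = - c ->
  exists d rho : k, [/\ d ^+ (q ^ 2) = d, d ^+ q - d != 0
                      & rho ^+ (q ^ n + 1) * (d ^+ q - d) = c].
Proof.
move=> q_gt1 pcharq odd_n hk c0 cqn; have q_gt0 := ltnW q_gt1.
have n_gt0 : (0 < n)%N by case: (n) odd_n.
have nE : (n = n./2 * 2 + 1)%N.
  by rewrite -{1}(odd_double_half n) odd_n addnC muln2.
have [g gprim] := finField_primitive_root k.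
have qn_gt1 : (1 < q ^ n)%N by rewrite -{1}(exp1n n) ltn_exp2r.
have q2_gt1 : (1 < q ^ 2)%N by rewrite -{1}(exp1n 2) ltn_exp2r.
have cardk : (#|k|.-1 = (q ^ n - 1) * (q ^ n + 1))%N.
  by rewrite hk mulnC expnM -subn1 -[in X in (_ - X)%N](exp1n 2) subn_sqr.
have /dvdnP[N NE] : (q ^ 2 - 1 %| #|k|.-1)%N.
  by rewrite hk expnM subn1; exact: dvdn_pred_predX.
have N_gt0 : (0 < N)%N.
  rewrite lt0n; apply/eqP => N0; move: NE; rewrite N0 mul0n cardk => /eqP.
  by rewrite muln_eq0 subn_eq0 leqNgt qn_gt1 addn1.
pose d := g ^+ N.
have d0 : d != 0.
  apply/expf_neq0; apply: contra_eq_neq (prim_expr_order gprim) => ->.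
  by rewrite expr0n eqn0Ngt (prim_order_gt0 gprim) eq_sym oner_neq0.
have dq2 : d ^+ (q ^ 2) = d.
  rewrite -(subnK (ltnW q2_gt1)) exprD expr1 -[X in X * _]exprM -NE.
  by rewrite (prim_expr_order gprim) mul1r.
(* The order of [d] is q^2 - 1, which exceeds q - 1, so [d] lies outside F_q. *)
have dq : d ^+ q - d != 0.
  rewrite subr_eq0 -(subnK q_gt0) exprD expr1 -[X in _ != X]mul1r.
  apply/negP => /eqP/(mulIf d0); rewrite -exprM => /eqP.
  rewrite -(prim_order_dvd gprim) NE => /(dvdn_leq _); rewrite muln_gt0 N_gt0.
  rewrite subn_gt0 q_gt1 => /(_ isT); rewrite leq_pmul2l //.
  by rewrite leqNgt ltn_sub2r // -{1}(expn1 q) ltn_exp2l.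
set c0' := d ^+ q - d in dq *.
have c0'q : c0' ^+ q = - c0'.
  rewrite /c0' exprDn_pchar // exprNn_pchar // -exprM mulnn dq2.
  by rewrite opprB.
have c0'qn : c0' ^+ (q ^ n) = - c0'.
  have E j : c0' ^+ (q ^ (2 * j)) = c0'.
    elim: j => [|j IHj]; first by rewrite expr1.
    rewrite mulnS expnD exprM -mulnn exprM c0'q.
    by rewrite exprNn_pchar // c0'q opprK IHj.
  rewrite nE expnD mulnC expn1 exprM [(_ * 2)%N]mulnC c0'q.
  by rewrite exprNn_pchar ?pnatX ?pcharq // E.
pose a := c / c0'.
have a0 : a != 0 by rewrite mulf_neq0 ?invr_neq0.
have aqn : a ^+ (q ^ n - 1) = 1.
  apply: (mulIf a0); rewrite -exprSr mul1r subn1 prednK ?(ltnW qn_gt1) //.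
  by rewrite expr_div_n cqn c0'qn invrN mulrNN.
have [j aE] : exists j, a = g ^+ j.
  have [|j ->] := prim_rootP gprim (x := a); last by exists j.
  by rewrite cardk exprM aqn expr1n.
(* Since a^(q^n-1) = 1, the order (q^n - 1)(q^n + 1) of [g] divides j (q^n - 1). *)
have /dvdnP[l lE] : (q ^ n + 1 %| j)%N.
  rewrite -(@dvdn_pmul2r (q ^ n - 1)) ?subn_gt0 // mulnC -cardk.
  by rewrite (prim_order_dvd gprim) exprM -aE aqn.
exists d, (g ^+ l); split=> //.
by rewrite -exprM -lE -aE divfK.
Qed.

(* With c' = d^q - d, the Hermitian curve s^(q+1) = c' (u^q - u) is           *)
(* parametrized by x = (u + d^q) / s and y = (u + d) / s.                     *)
Lemma BM_radical_coordinates (L : fieldType) q nu (d x y w : L)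
    (s := (d ^+ q - d) / (x - y)) (u := s * y - d)
    (B := 1 + (u ^+ q - u) ^+ (q - 1)) (z := s * w ^+ nu) :
    (1 < q)%N -> [pchar L].-nat q -> d ^+ (q ^ 2) = d -> d ^+ q - d != 0 ->
    y != 0 ->
    x ^+ (q + 1) - y ^+ (q + 1) = 1 ->
    w ^+ (nu * (q * (q - 1)) + 1) = (x ^+ (q ^ 2) - x) / y ^+ q ->
  [/\ s != 0, s * x = u + d ^+ q, s ^+ (q + 1) = (d ^+ q - d) * (u ^+ q - u),
      z ^+ (nu * (q * (q - 1)) + 1) = s * B ^+ nu & z ^+ (q * (q - 1)) * w = B].
Proof.
move=> q_gt1 pcharq dq2 d_nz y0 hxy hw; have q_gt0 := ltnW q_gt1.
have frobB (a b : L) : (a - b) ^+ q = a ^+ q - b ^+ q.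
  by rewrite exprDn_pchar // exprNn_pchar.
have frobD (a b : L) : (a + b) ^+ q = a ^+ q + b ^+ q by rewrite exprDn_pchar.
have xy : x - y != 0.
  apply: contra_eq_neq hxy => /eqP; rewrite subr_eq0 => /eqP ->.
  by rewrite subrr eq_sym oner_neq0.
have s0 : s != 0 by rewrite mulf_neq0 ?invr_neq0.
have sxy : s * (x - y) = d ^+ q - d by rewrite divfK.
have sy : s * y = u + d by rewrite subrK.
have sx : s * x = u + d ^+ q.
  by rewrite -[x](subrK y) mulrDr sxy sy addrCA subrK.
clearbody u; clearbody s.
have dqq : (d ^+ q) ^+ q = d by rewrite -exprM mulnn.
have c'q : (d ^+ q - d) ^+ q = - (d ^+ q - d) by rewrite frobB dqq opprB.
(* The q-power map exchanges [d] and d^q, so (u + d^q)^(q+1) - (u + d)^(q+1) factors as shown. *)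
have sq1 : s ^+ (q + 1) = (d ^+ q - d) * (u ^+ q - u).
  rewrite -[LHS]mulr1 -hxy mulrBr -!exprMn sx sy !exprD !expr1 !frobD dqq.
  have <- : u + d + (d ^+ q - d) = u + d ^+ q.
    by rewrite [_ - d]addrC addrA addrK.
  have <- : u ^+ q + d + (d ^+ q - d) = u ^+ q + d ^+ q.
    by rewrite [_ - d]addrC addrA addrK.
  rewrite mulrDr [(_ + (_ - _)) * _]mulrDl opprD addrACA subrr add0r.
  rewrite [(_ + _) * (_ - _)]mulrC -mulrBr opprD addrACA.
  by rewrite subrr addr0.
have uq0 : u ^+ q - u != 0.
  by apply: contraNneq (expf_neq0 (q + 1) s0) => uq0; rewrite sq1 uq0 mulr0.
(* Thus B = (u^(q^2) - u) / (u^q - u). *)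
have uqB : (u ^+ q - u) * B = (u ^+ q) ^+ q - u.
  rewrite /B mulrDr mulr1 -exprS subn1 prednK // frobB.
  by rewrite addrC subrKA.
have sq2 : (u ^+ q - u) * s ^+ (q ^ 2 - 1) = - ((u ^+ q) ^+ q - u ^+ q).
  have -> : (q ^ 2 - 1 = (q + 1) * (q - 1))%N.
    by rewrite -[X in (_ - X)%N](exp1n 2) subn_sqr mulnC.
  have c'q1 : (d ^+ q - d) ^+ (q - 1) = -1.
    by apply: (mulIf d_nz); rewrite -exprSr subn1 prednK // c'q mulN1r.
  rewrite exprM sq1 exprMn c'q1 mulN1r mulrN -exprS subn1 prednK //.
  by rewrite frobB.
have wB : w ^+ (nu * (q * (q - 1)) + 1) * s ^+ (q * (q - 1)) = B.
  have yq0 : y ^+ q != 0 by rewrite expf_neq0.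
  have syq : (s * y) ^+ q != 0 by rewrite expf_neq0 ?mulf_neq0.
  have sqq : s ^+ (q * (q - 1)) * s ^+ q = s ^+ (q ^ 2).
    by rewrite -exprD -mulnSr subn1 prednK // mulnn.
  have sq2S : s ^+ (q ^ 2) = s ^+ (q ^ 2 - 1) * s.
    by rewrite -exprSr subn1 prednK // expn_gt0 q_gt0.
  (* After these multiplications both sides become polynomials in [u] and [d]. *)
  apply: (mulIf syq); apply: (mulfI uq0).
  have -> : w ^+ (nu * (q * (q - 1)) + 1) * s ^+ (q * (q - 1)) * (s * y) ^+ q
          = (s * x) ^+ (q ^ 2) - s ^+ (q ^ 2 - 1) * (s * x).
    rewrite hw [(s * y) ^+ q]exprMn [LHS]mulrA -[_ / _ * _ * _]mulrA sqq.
    rewrite mulrAC divfK //.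
    by rewrite mulrBl mulrC -exprMn [x * _]mulrC sq2S -mulrA.
  rewrite [RHS]mulrA uqB sx sy mulrBr mulrA sq2 mulNr opprK.
  rewrite -mulnn exprM !frobD dqq.
  rewrite -(subrKA (u ^+ q) ((u ^+ q) ^+ q) (d ^+ q)).
  rewrite -(subrKA (u ^+ q) ((u ^+ q) ^+ q) (- u)).
  have -> : u + d ^+ q = u ^+ q + d ^+ q - (u ^+ q - u).
    by rewrite opprB [RHS]addrC subrKA.
  have alg (a b e : L) : b * (a + e) + a * (e - b) = (a + b) * e.
    by rewrite mulrDl mulrDr mulrBr [b * a]mulrC addrC addrA subrK.
  exact: alg.
split=> //.
- rewrite /z -wB !exprMn -!exprM [RHS]mulrCA -exprS mulrC.
  by congr (w ^+ _ * s ^+ _); rewrite mulnC // addn1.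
- rewrite /z exprMn -exprM -mulrA -exprSr mulrC.
  by move: wB; rewrite addn1.
Qed.

Definition BM_radicand (k : fieldType) q e (c : k) : {poly k} :=
  c%:P * ('X^q - 'X) * (1 + ('X^q - 'X) ^+ (q - 1)) ^+ e.

Lemma eval_BM_radicand (k K : fieldType) (iota : {rmorphism k -> K}) q e c u :
  eval_poly iota u (BM_radicand q e c) =
    iota c * (u ^+ q - u) * (1 + (u ^+ q - u) ^+ (q - 1)) ^+ e.
Proof.
have E : eval_poly iota u ('X^q - 'X) = u ^+ q - u.
  by rewrite rmorphB rmorphXn /= eval_polyX.
rewrite !rmorphM /= E eval_polyC rmorphXn; congr (_ * _ ^+ _).
by rewrite rmorphD rmorph1 rmorphXn /= E.
Qed.

Lemma BM_radicand_root0 (k : fieldType) q e (c : k) :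
  (1 < q)%N -> root (BM_radicand q e c) 0.
Proof.
move=> q_gt1; apply/rootP; rewrite /BM_radicand !hornerE.
rewrite expr0n gtn_eqF ?(ltnW q_gt1) //.
by rewrite subr0 mulr0 mul0r.
Qed.

(** At 0 the derivative of X^q - X is -1 and the last factor is 1, so the derivative there is
    [- c]. *)
Lemma BM_radicand_simple0 (k : fieldType) q e (c : k) :
  (1 < q)%N -> c != 0 -> ~~ root (BM_radicand q e c)^`() 0.
Proof.
move=> q_gt1 c0; rewrite /BM_radicand rootE !derivM derivB.
rewrite derivXn derivX derivC.
rewrite !hornerE !expr0n !gtn_eqF ?(ltnW q_gt1) -?subn1 ?subn_gt0 //.
rewrite hornerMn hornerXn expr0n gtn_eqF ?subn_gt0 //.
rewrite !(mulr0n, mul0rn, subr0, mulr0, mul0r, addr0).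
rewrite expr0n gtn_eqF ?subn_gt0 // !(mulr0n, addr0, sub0r) expr1n mulr1.
by rewrite mulrN1 oppr_eq0.
Qed.

Theorem proposition2p1
  (q n m : nat)
  (hq : exists p e : nat, [/\ prime p, (0 < e)%N & q = (p ^ e)%N])
  (hn3 : (3 <= n)%N) (hn : odd n)
  (hm : m = ((q ^ n + 1) %/ (q + 1))%N)
  (k : finFieldType) (hk : #|k| = (q ^ (2 * n))%N)
  (c : k) (hc0 : c != 0) (hc : c ^+ (q ^ n) = - c)
  (* K = k(u, z), the function field of X_{q,n} *)
  (K : fieldType) (iK : {rmorphism k -> K}) (u z : K)
  (hu : ~ algebraicOver iK u)
  (hK : field_adjoin iK [set u; z] = setT)
  (huz : z ^+ (q ^ n + 1) =
         iK c * (u ^+ q - u) *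
         (1 + (u ^+ q - u) ^+ (q - 1)) ^+ ((q ^ (n - 1) - 1) %/ (q - 1)))
  (* L = k(x, y, w), the function field of the Beelen-Montanucci curve *)
  (L : fieldType) (iL : {rmorphism k -> L}) (x y w : L)
  (hx : ~ algebraicOver iL x)
  (hL : field_adjoin iL [set x; y; w] = setT)
  (hxy : x ^+ (q + 1) - y ^+ (q + 1) = 1)
  (hw : w ^+ m = (x ^+ (q ^ 2) - x) / y ^+ q)
  (X : set (set K)) (hX : nonsingular_projective_curve iK X)
  (Y : set (set L)) (hY : nonsingular_projective_curve iL Y) :
  curve_isomorphic iK iL X Y.
Proof.
have [p [e [p_pr e_gt0 qE]]] := hq.
have q_gt1 : (1 < q)%N.
  by rewrite qE -{1}(exp1n e) ltn_exp2r // prime_gt1.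
have q_gt0 := ltnW q_gt1.
have pk : p \in [pchar k].
  by apply: (@finField_pchar _ _ (e * (2 * n))); rewrite // hk qE -expnM.
have pchar_q (F : fieldType) : p \in [pchar F] -> [pchar F].-nat q.
  by move=> pF; rewrite qE pnatX pnatE // pF.
have pchark := pchar_q k pk.
have pcharL : [pchar L].-nat q by apply: pchar_q; apply: rmorph_pchar pk.
have [nu [eE mE Mm]] := BM_exponents q_gt1 hn.
rewrite eE in huz; rewrite mE in hm; rewrite hm in hw.
have [d [rho [dq2 dq rhoE]]] := BM_constants q_gt1 pchark hn hk hc0 hc.
pose f := BM_radicand q (nu * (q + 1)) c.
have alg_root N (a : L) :
    (0 < N)%N -> algebraicOver iL (a ^+ N) -> algebraicOver iL a.
  exact: algebraic_root_power.
(* With [y = 0] the equation makes [x] a root of unity, hence algebraic. *)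
have y0 : y != 0.
  apply/eqP => y0; apply: hx; apply: (alg_root (q + 1)%N).
    by rewrite addn1.
  rewrite -(subrK (y ^+ (q + 1)) (x ^+ (q + 1))) hxy y0 expr0n addn1 addr0.
  exact: algebraic1.
have Ld2 : iL d ^+ (q ^ 2) = iL d by rewrite -rmorphXn dq2.
have Ldq : iL d ^+ q - iL d != 0 by rewrite -rmorphXn -rmorphB fmorph_eq0.
have := BM_radical_coordinates q_gt1 pcharL Ld2 Ldq y0 hxy hw.
set s := (_ - _) / (x - y); set u' := s * y - iL d; set B := 1 + _.
set z0 := s * w ^+ nu => -[s0 sx sq zm zr].
(* The factor [rho] replaces the constant d^q - d by [c]. *)
pose z' := iL rho * z0.
have M_gt0 : (0 < q ^ n + 1)%N by rewrite addn1.
have huz' : z' ^+ (q ^ n + 1) = eval_poly iL u' f.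
  rewrite eval_BM_radicand exprMn [in z0 ^+ _]Mm exprM zm exprMn sq -exprM -/B.
  by rewrite -rhoE rmorphM rmorphXn rmorphB rmorphXn /= !mulrA.
(* If [u'] were algebraic, so would be [s], by its (q+1)-st power, and then x = (u' + d^q) / s. *)
have hu' : ~ algebraicOver iL u'.
  move=> algu; apply: hx.
  have algd j : algebraicOver iL (iL d ^+ j).
    by rewrite -rmorphXn; apply: algebraic_id.
  have algs : algebraicOver iL s.
    apply: (alg_root (q + 1)%N); first by rewrite addn1.
    rewrite sq; apply: algebraic_mul.
      by apply: algebraic_sub => //; apply: (algd 1).
    have -> : u' ^+ q - u' = eval_poly iL u' ('X^q - 'X).
      by rewrite rmorphB rmorphXn /= eval_polyX.
    by apply: algebraic_eval_poly => // a; apply: algebraic_id.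
  rewrite -(mulKf s0 x) sx mulrC; apply: algebraic_div => //.
  by apply: algebraic_add.
(* If [w = 0], then x^(q^2) = x and [x] is algebraic. *)
have w0 : w != 0.
  apply: contra_not_neq hx => w0; move/eqP: hw.
  rewrite w0 addn1 expr0n /= eq_sym.
  rewrite mulf_eq0 invr_eq0 expf_eq0 (negPf y0) andbF orbF subr_eq0 => /eqP xq2.
  have [->|x0] := eqVneq x 0; first exact: algebraic0.
  have q2_gt1 : (1 < q ^ 2)%N by rewrite -{1}(exp1n 2) ltn_exp2r.
  apply: (alg_root (q ^ 2 - 1)%N); first by rewrite subn_gt0.
  have -> : x ^+ (q ^ 2 - 1) = 1; last exact: algebraic1.
  by apply: (mulIf x0); rewrite -exprSr subn1 prednK ?(ltnW q2_gt1) // mul1r.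
have z00 : z0 != 0 by rewrite mulf_neq0 ?expf_neq0.
have B0 : B != 0 by rewrite -zr mulf_neq0 ?expf_neq0.
have rho0 : iL rho != 0.
  rewrite fmorph_eq0; apply: contraNneq hc0 => rho0.
  by rewrite -rhoE rho0 expr0n addn1 mul0r.
(* From [u'] one gets [B], from [z'] one gets [z0]; then s = z0^m / B^nu yields [x] and [y], and w =
   B / z0^(q(q-1)). *)
have hL' : field_adjoin iL [set u'; z'] = setT.
  have divE := field_adjoin_divring iL [set u'; z'].
  have EB a : field_adjoin iL [set u'; z'] (iL a) by apply: field_adjoin_base.
  have Eu : field_adjoin iL [set u'; z'] u' by apply: field_adjoin_gen; left.
  have Ez' : field_adjoin iL [set u'; z'] z' by apply: field_adjoin_gen; right.
  set E := field_adjoin _ _ in divE EB Eu Ez' *; clearbody E.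
  have subE : subring_closed (mem E) := divE.
  have Ediv a b : E a -> E b -> E (a / b).
    by have [_ _ /(_ a b)] := divE; rewrite !inE.
  have Ez : E z0 by rewrite -(mulKf rho0 z0) mulrC; apply: Ediv.
  have EBv : E B.
    rewrite /B; apply: subringD => //; first exact: subring1.
    by apply: subringX => //; apply: subringB => //; apply: subringX.
  have Es : E s.
    rewrite -(mulfK (expf_neq0 nu B0) s) -zm.
    by apply: Ediv; apply: subringX.
  have Ex : E x.
    rewrite -(mulKf s0 x) sx mulrC; apply: Ediv => //.
    by apply: subringD => //; apply: subringX.
  have Ey : E y.
    rewrite -(mulKf s0 y) mulrC; apply: Ediv => //.
    by rewrite -(subrK (iL d) (s * y)); apply: subringD.
  have Ew : E w.
    rewrite -(mulKf (expf_neq0 (q * (q - 1)) z00) w) zr mulrC.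
    by apply: Ediv => //; apply: subringX.
  apply/seteqP; split=> // a _.
  have aL : field_adjoin iL [set x; y; w] a by rewrite hL.
  by apply: (aL E); split=> // _ [[b _ <-]|[[->|->]|->]].
have f0 : root f 0 := BM_radicand_root0 _ _ q_gt1.
have f1 : ~~ root f^`() 0 := BM_radicand_simple0 _ q_gt1 hc0.
rewrite -eval_BM_radicand -/f in huz.
have [h [g [hg gh hi]]] :=
  radical_extension_isom f0 f1 M_gt0 hu huz hK hu' huz' hL'.
rewrite (nonsingular_projective_curve_valuations
  (algebraically_dependent hK M_gt0 huz) hX).
rewrite (nonsingular_projective_curve_valuations
  (algebraically_dependent hL' M_gt0 huz') hY).
exact: valuation_curves_isomorphic hg gh hi.
Qed.
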